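(* Let $K$ users and $N$ remote radio heads (RRHs) be uniformly distributed over a square of side length $r_0$, let $\delta=K/r_0^2$ be the user density, and let $r$ be the distance threshold defining which users an RRH serves. As $K\to\infty$ and $\frac{\delta r^2}{\ln K}\to\rho$, where $\rho\in(0,+\infty)$ is a predetermined constant, the minimum training length $\alpha T$ preserving local orthogonality satisfies $$\limsup_{K\to\infty}\left(\frac{\alpha T}{\delta r^2}\right)\ \leq\ 4f^{-1}\!\left(\frac{1}{4\rho}\right)\quad\text{almost surely},$$ where $f^{-1}$ is the inverse function, over the domain $[1,+\infty)$, of $f(x)=1-x+x\ln x$.
   Context: The setting is a cloud radio access network. Users have positions $\mathbf{u}_k\in\mathbb{R}^{1\times 2}$, $k=1,\dots,K$, and RRHs have positions $\mathbf{b}_i\in\mathbb{R}^{1\times 2}$, $i=1,\dots,N$. User $k$ is served by RRH $i$ if $\|\mathbf{b}_i-\mathbf{u}_k\|_\infty<r$; $\mathcal{U}_i$ denotes the set of users served by RRH $i$. A transmission frame consists of $T$ channel uses, of which $\alpha T$ (the training length, with time-splitting factor $\alpha\in(0,1)$) are used for training; user $k$ transmits a training sequence $\mathbf{x}_k^{\mathrm p}\in\mathbb{C}^{1\times\alpha T}$. Local orthogonality means that $\mathbf{x}_k^{\mathrm p}\perp\mathbf{x}_{k'}^{\mathrm p}$ for all $k\neq k'$ in $\mathcal{U}_i$ and for every RRH $i$. The minimum training length preserving local orthogonality is the smallest $\alpha T$ for which sequences $\mathbf{x}_1^{\mathrm p},\dots,\mathbf{x}_K^{\mathrm p}\in\mathbb{C}^{1\times\alpha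 T}$ satisfying local orthogonality exist; it is a random variable depending on the random locations of users and RRHs. *)

(* Defs.v *)
From HB Require Import structures.
From mathcomp Require Import all_boot all_order all_algebra.
From mathcomp Require Import spectral complex.
From mathcomp Require Import all_classical all_reals all_analysis.

Set Implicit Arguments.
Unset Strict Implicit.
Unset Printing Implicit Defensive.

Import Order.TTheory GRing.Theory Num.Theory.
Import numFieldNormedType.Exports.

Local Open Scope classical_set_scope.
Local Open Scope ring_scope.

(* On R * R the library norm `|_| is the maximum of the norms of the two
   components, i.e. the l_oo norm. *)
Definition served (R : realType) (r : R) (b u : R * R) : bool := `|b - u| < r.

Definition served_users (R : realType) (K N : nat) (r : R)
    (u : 'I_K -> R * R) (b : 'I_N -> R * R) (i : 'I_N) : {set 'I_K} :=
  [set k | served r (b i) (u k)]%SET.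

(* [dotmx] is the Hermitian inner product on row vectors. *)
Definition locally_orthogonal (R : realType) (K N L : nat) (r : R)
    (u : 'I_K -> R * R) (b : 'I_N -> R * R) (x : 'I_K -> 'rV[R[i]]_L) : Prop :=
  forall i : 'I_N, {in served_users r u b i &, forall k k' : 'I_K,
    k != k' -> dotmx (x k) (x k') = 0}.

(* Training sequences carry positive power: without the condition x k != 0 the
   zero sequences would be locally orthogonal in every length. *)
Definition feasible_length (R : realType) (K N : nat) (r : R)
    (u : 'I_K -> R * R) (b : 'I_N -> R * R) (L : nat) : Prop :=
  exists x : 'I_K -> 'rV[R[i]]_L,
    (forall k, x k != 0) /\ locally_orthogonal r u b x.

Lemma feasible_length_ex (R : realType) (K N : nat) (r : R)
    (u : 'I_K -> R * R) (b : 'I_N -> R * R) :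
  exists L, `[< feasible_length r u b L >].
Proof.
exists K; apply/asboolP; exists (fun k => delta_mx 0 k); split=> [k|i k k' _ _ nkk'].
  apply/negP => /eqP/matrixP/(_ 0 k); rewrite !mxE !eqxx => /eqP.
  by rewrite oner_eq0.
rewrite dotmxE mxE big1// => j _; rewrite !mxE !eqxx /=.
have [->|_] := eqVneq j k; last by rewrite mul0r.
by rewrite (negbTE nkk') /= conjC0 mulr0.
Qed.

Definition min_training_length (R : realType) (K N : nat) (r : R)
    (u : 'I_K -> R * R) (b : 'I_N -> R * R) : nat :=
  ex_minn (feasible_length_ex r u b).

Definition uniform_on_square d (T : measurableType d) (R : realType)
    (P : probability T R) (a : R) (X : {RV P >-> (R * R)%type}) : Prop :=
  forall A : set (R * R), measurable A ->
    distribution P X A =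
    ((a ^- 2)%:E *
     (lebesgue_measure \x lebesgue_measure) (A `&` (`[0%R, a] `*` `[0%R, a])))%E.

Definition mutually_independent d (T : measurableType d) (R : realType)
    (P : probability T R) (I : finType) (X : I -> {RV P >-> (R * R)%type}) : Prop :=
  forall (J : {set I}) (A : I -> set (R * R)), (forall j, measurable (A j)) ->
    P (\bigcap_(j in [set` J]) (X j @^-1` A j)) =
    (\prod_(j in J) P (X j @^-1` A j))%E.

(* Users and RRHs of one network, as a single family. *)
Definition nodes (X : Type) (K N : nat) (u : 'I_K -> X) (b : 'I_N -> X)
    (j : 'I_K + 'I_N) : X :=
  match j with inl k => u k | inr i => b i end.

(* Almost sure convergence as K grows refers to one infinite sequence of users:
   the network with K users consists of the first K of them, each keeping its
   relative location u / a in the square when the side length a = a K varies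
   with K.  For a constant side length this says that u K k does not depend
   on K. *)
Definition nested_users (T : Type) (R : realType) (a : nat -> R)
    (u : forall K : nat, 'I_K -> T -> R * R) : Prop :=
  forall (K K' : nat) (k : 'I_K) (k' : 'I_K') (w : T),
    k = k' :> nat -> (a K)^-1 *: u K k w = (a K')^-1 *: u K' k' w.

Definition rate_fun (R : realType) (x : R) : R := 1 - x + x * ln x.

(* Inverse of the bijection [rate_fun] from [1, +oo[ to [0, +oo[; junk at
   negative arguments. *)
Definition rate_inv (R : realType) : R -> R :=
  pinv (`[1, +oo[ : set R) (@rate_fun R).

Definition user_density (R : realType) (K : nat) (a : R) : R := K%:R / a ^+ 2.

(* Main.v *)
(* Users sharing an RRH are at l_oo distance less than 2r, so the minimum length is
   at most the chromatic number of the random geometric graph of radius 2r. Cut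
   the square into cells of side 2r / (Q - 1), Q large. Distinct cells congruent
   mod Q in both coordinates are pairwise non-adjacent, so in a box of bounded
   size the number of colours is the sum over the Q^2 residue classes of the
   fullest cell of the class, i.e. the number of points in a union of Q^2 cells,
   of total area about 4r^2. There are only boundedly many such unions per box
   and O(K) boxes, hence Chernoff's bound P(count >= x mu) <= exp(- mu f(x))
   with mu ~ 4 rho ln K makes x mu colours enough as soon as 4 rho f(x) > 1.
   Boxes are glued by averaging over shifted box decompositions. For almost sure
   convergence, Borel-Cantelli is applied along K = (m+2)^q with q large, and
   nestedness of the users interpolates between consecutive such K, whose ratio
   tends to 1. *)

Require Import Defs.
From HB Require Import structures.
From mathcomp Require Import all_boot all_order all_algebra.
From mathcomp Require Import spectral complex.
From mathcomp Require Import all_classical all_reals all_analysis.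
From mathcomp Require Import measurable_realfun zify ring lra.

Set Implicit Arguments.
Unset Strict Implicit.
Unset Printing Implicit Defensive.

Import Order.TTheory GRing.Theory Num.Theory.
Import numFieldNormedType.Exports.

(** * Colouring points of a grid *)

(* Numbers the pairs (s, q) with q < w s injectively; junk when w s <= q. *)
Definition sum_index (S : finType) (w : S -> nat) (s : S) (q : nat) : nat :=
  if insub q : option 'I_(w s) is Some o
  then enum_rank (Tagged (fun s => 'I_(w s)) o) else 0.

Lemma sum_index_lt (S : finType) (w : S -> nat) (s : S) (q : nat) :
  q < w s -> sum_index w s q < \sum_s w s.
Proof.
rewrite /sum_index => qw; rewrite insubT.
have -> : \sum_s w s = #|{: {s : S & 'I_(w s)}}|.
  by rewrite card_tagged sumnE big_map big_enum; apply: eq_bigr => t _; rewrite card_ord.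
exact: ltn_ord.
Qed.

Lemma sum_index_inj (S : finType) (w : S -> nat) (s s' : S) (q q' : nat) :
  q < w s -> q' < w s' -> sum_index w s q = sum_index w s' q' ->
  s = s' /\ q = q'.
Proof.
rewrite /sum_index => qw qw'; rewrite !insubT => /ord_inj/enum_rank_inj e.
have ss' := congr1 tag e; rewrite /= in ss'; subst s'.
by move: e => /eqP; rewrite eq_Tagged => /eqP /(congr1 val).
Qed.

(* A cell (i, j) has block (i %/ Q, j %/ Q) and residue class
   s = (i %% Q, j %% Q); here the block is written beta + o with o ranging over
   a box of B * B blocks. *)
Definition box_cell (Q B : nat) (beta : nat * nat) (o : 'I_B * 'I_B)
    (s : 'I_Q * 'I_Q) : nat * nat :=
  ((beta.1 + o.1) * Q + s.1, (beta.2 + o.2) * Q + s.2).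

Lemma box_cell_inj (Q B : nat) beta (o o' : 'I_B * 'I_B) (s s' : 'I_Q * 'I_Q) :
  box_cell beta o s = box_cell beta o' s' -> s = s'.
Proof.
case: s s' => [s1 s2] [s1' s2'] [/= e1 e2].
have /= := congr1 (fun x => x %% Q) e1; have /= := congr1 (fun x => x %% Q) e2.
rewrite !modnMDl !modn_small //.
by move=> /ord_inj -> /ord_inj ->.
Qed.

(** Let [g s] pick the fullest cell of class [s]. Cells of different classes are distinct, so each
    point is counted at most once and the maxima add up to the size of one union of cells. *)
Lemma sum_max_cell_le (n Q B D : nat) (c : 'I_n -> nat * nat) (beta : nat * nat) :
  (forall g : {ffun 'I_Q * 'I_Q -> 'I_B.+1 * 'I_B.+1},
    #|[set k | [exists s, c k == box_cell beta (g s) s]]| <= D) ->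
  \sum_(s : 'I_Q * 'I_Q) \max_(o : 'I_B.+1 * 'I_B.+1)
     #|[set k | c k == box_cell beta o s]| <= D.
Proof.
move=> H.
pose g := [ffun s : 'I_Q * 'I_Q => [arg max_(o > (ord0, ord0) : 'I_B.+1 * 'I_B.+1)
   #|[set k | c k == box_cell beta o s]|]].
apply: leq_trans (H g).
under eq_bigr => s _.
  rewrite (@bigop.bigmax_eq_arg _ (ord0, ord0)) //.
  have -> : [arg max_(o > (ord0, ord0) : 'I_B.+1 * 'I_B.+1)
   #|[set k | c k == box_cell beta o s]|] = g s by rewrite ffunE.
  rewrite -sum1_card big_mkcond /=.
  over.
rewrite exchange_big /= -sum1_card [leqRHS]big_mkcond /=.
apply: leq_sum => k _; rewrite inE.
case: (boolP [exists s, c k == box_cell beta (g s) s]) => [/existsP[s0 /eqP e0]|/existsPn ne].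
  rewrite (bigD1 s0)//= inE {1}e0 eqxx big1// => s ss0; rewrite inE.
  case: eqP => // e; case/eqP: ss0; apply: (@box_cell_inj Q B.+1 beta (g s) (g s0)).
  by rewrite -e -e0.
by rewrite big1// => s _; rewrite inE (negbTE (ne s)).
Qed.

(* For the shift t, the blocks congruent to t mod B are removed and separate
   boxes of B.-1 consecutive blocks; this is the first block of the box of i.
   For the first box the truncated subtraction clips the origin to 0. *)
Definition shift_origin (B t i : nat) : nat :=
  (i + (B.-1 - t)) %/ B * B - (B.-1 - t).

Lemma shift_origin_ge (B t i : nat) : 0 < B -> t < B ->
  shift_origin B t i <= i < shift_origin B t i + B.
Proof.
rewrite /shift_origin => B0 tB.
have := divn_eq (i + (B.-1 - t)) B; have := ltn_pmod (i + (B.-1 - t)) B0.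
move: (_ %/ B) => x; move: (_ %% B) => y; move: (x * B) => z; lia.
Qed.

(** The quotient defining the origin jumps between [i] and [i.+1] only when [i] is congruent to [t]
    mod [B], that is, when block [i] is a removed one. *)
Lemma shift_origin_succ (B t i : nat) : t < B -> t != i %% B -> 
  shift_origin B t i.+1 = shift_origin B t i.
Proof.
rewrite /shift_origin => tB ti; have B0 : 0 < B by apply: leq_ltn_trans tB.
congr (_ * _ - _); rewrite addSn.
rewrite divnS// ; case: (boolP (_ %| _)) => // /dvdnP[x ex].
exfalso; move/eqP: ti; apply.
have e : i + B = x * B + t.
  by move: ex; move: (x * B) => z; lia.
by have := congr1 (fun z => z %% B) e; rewrite modnDr modnMDl (modn_small tB).
Qed.

Lemma shift_origin_near (B t i i' : nat) : t < B -> t != i %% B -> t != i' %% B ->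
  i <= i'.+1 -> i' <= i.+1 -> shift_origin B t i = shift_origin B t i'.
Proof.
move=> tB ti ti' h h'.
have [->|->|->] : [\/ i = i', i = i'.+1 | i' = i.+1].
  by case: (ltngtP i i') => e; [apply: Or33|apply: Or32|apply: Or31]; lia.
- by [].
- exact: shift_origin_succ.
- by rewrite shift_origin_succ.
Qed.

Lemma near_divn (Q i i' : nat) : 0 < Q -> i < i' + Q -> i %/ Q <= (i' %/ Q).+1.
Proof.
move=> Q0 h; rewrite -ltnS -addn2 ltn_divLR// mulnDl.
have := divn_eq i' Q; have := ltn_pmod i' Q0.
by move: (_ %/ Q * Q) => z; lia.
Qed.

Lemma near_modn (Q i i' : nat) : 0 < Q -> i < i' + Q -> i' < i + Q ->
  i %% Q = i' %% Q -> i = i'.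
Proof.
move=> Q0 h h' e.
have := divn_eq i' Q; have := divn_eq i Q; rewrite e.
case: (ltngtP (i %/ Q) (i' %/ Q)) => H; last by move=> ei ei'; rewrite ei H -ei'.
  have : (i %/ Q).+1 * Q <= i' %/ Q * Q by rewrite leq_mul2r H orbT.
  rewrite mulSn; move: (_ * _) (_ * _) => x y; lia.
have : (i' %/ Q).+1 * Q <= i %/ Q * Q by rewrite leq_mul2r H orbT.
rewrite mulSn; move: (_ * _) (_ * _) => x y; lia.
Qed.

(** Ranking the points of a cell spreads them evenly: the rank mod [b] will select the shift and the
    quotient by [b] the colour within that shift. *)
Definition cell_rank (n : nat) (c : 'I_n -> nat * nat) (k : 'I_n) : nat :=
  #|[set k' : 'I_n | (k' < k) && (c k' == c k)]|.

Lemma cell_rank_lt (n : nat) (c : 'I_n -> nat * nat) (k : 'I_n) :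
  cell_rank c k < #|[set k' | c k' == c k]|.
Proof.
apply: proper_card; apply/fintype.properP; split.
  by apply/fintype.subsetP => x; rewrite !inE => /andP[].
by exists k; rewrite !inE ?eqxx // ltnn.
Qed.

Lemma cell_rank_inj (n : nat) (c : 'I_n -> nat * nat) (k k' : 'I_n) :
  c k = c k' -> cell_rank c k = cell_rank c k' -> k = k'.
Proof.
wlog lt : k k' / k < k' => [W|] e.
  case: (ltngtP k k') => [lt|lt|/ord_inj//] r; first exact: W.
  by apply/esym/W.
move=> /eqP; rewrite ltn_eqF // /cell_rank; apply: proper_card; apply/fintype.properP; split.
  apply/fintype.subsetP => x; rewrite !inE e => /andP[xk ->]; rewrite andbT.
  exact: ltn_trans lt.
by exists k; rewrite !inE ?lt ?e ?eqxx // ltnn.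
Qed.

Definition kept_shifts (B : nat) (i j : nat) : seq 'I_B :=
  enum [set t : 'I_B | (t != i %% B :> nat) && (t != j %% B :> nat)].

(** At most two residues are excluded, one per coordinate of the block. *)
Lemma size_kept_shifts (b i j : nat) : b <= size (kept_shifts b.+2 i j).
Proof.
rewrite -cardE.
have -> : [set t : 'I_b.+2 | (t != i %% b.+2 :> nat) && (t != j %% b.+2 :> nat)] =
  ~: [set inord (i %% b.+2); inord (j %% b.+2)].
  apply/setP => t; rewrite !inE negb_or -!val_eqE /= !inordK ?ltn_pmod //.
rewrite cardsCs finset.setCK card_ord cards2; case: (_ != _) => /=; lia.
Qed.

(* Within a box, cells of the same residue class are never close, so they share
   colours and a class costs as many colours as its fullest cell: a box needs at
   most the number D of points in one well chosen cell per class.  The points of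
   each cell are spread evenly over b of the b.+2 shifts that keep its block, so
   that each shift only has to colour a fraction 1 / b of them. *)
Lemma shifted_coloring (n Q b G D : nat) (c : 'I_n -> nat * nat) :
  0 < Q -> 0 < b -> (forall k, (c k).1 < G /\ (c k).2 < G) ->
  (forall (beta : 'I_G * 'I_G) (g : {ffun 'I_Q * 'I_Q -> 'I_b.+2 * 'I_b.+2}),
    #|[set k | [exists s, c k == box_cell (beta.1 : nat, beta.2 : nat) (g s) s]]| <= D) ->
  exists f : 'I_n -> 'I_b.+2 * 'I_(D %/ b + Q * Q),
    forall k k', k != k' -> f k = f k' ->
      ~ [/\ (c k).1 < (c k').1 + Q, (c k').1 < (c k).1 + Q,
           (c k).2 < (c k').2 + Q & (c k').2 < (c k).2 + Q].
Proof.
move=> Q0 b0 cG H.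
pose I k := (c k).1 %/ Q; pose J k := (c k).2 %/ Q.
pose tau k : 'I_b.+2 := nth ord0 (kept_shifts b.+2 (I k) (J k)) (cell_rank c k %% b).
pose beta k := (shift_origin b.+2 (tau k) (I k), shift_origin b.+2 (tau k) (J k)).
(* The [+ 1] pays for rounding ranks down to quotients; summed over the classes it becomes the term
   [Q * Q]. *)
pose w be (s : 'I_Q * 'I_Q) :=
  (\max_(o : 'I_b.+2 * 'I_b.+2) #|[set k | c k == box_cell be o s]|) %/ b + 1.
pose s k : 'I_Q * 'I_Q :=
  (Ordinal (ltn_pmod (c k).1 Q0), Ordinal (ltn_pmod (c k).2 Q0)).
pose col k := sum_index (w (beta k)) (s k) (cell_rank c k %/ b).
have tauP k : (tau k != I k %% b.+2 :> nat) && (tau k != J k %% b.+2 :> nat).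
  have : tau k \in kept_shifts b.+2 (I k) (J k).
    by apply: mem_nth; apply: leq_trans (size_kept_shifts _ _ _); rewrite ltn_pmod.
  by rewrite mem_enum inE.
have rank_w k : cell_rank c k %/ b < w (beta k) (s k).
  rewrite /w addn1 ltnS; apply: leq_div2r.
  have /andP[h1 h1'] := @shift_origin_ge b.+2 (tau k) (I k) isT (ltn_ord _).
  have /andP[h2 h2'] := @shift_origin_ge b.+2 (tau k) (J k) isT (ltn_ord _).
  have o1 : I k - (beta k).1 < b.+2 by rewrite /beta /=; lia.
  have o2 : J k - (beta k).2 < b.+2 by rewrite /beta /=; lia.
  (* The cell of [k] itself is one of the cells over which the maximum is taken. *)
  apply: leq_trans (leq_bigmax (Ordinal o1, Ordinal o2)).
  apply: leq_trans (ltnW (cell_rank_lt c k)) _.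
  apply/subset_leq_card/fintype.subsetP => k'; rewrite !inE => /eqP ->.
  rewrite /box_cell /= !subnKC // -!divn_eq; by case: (c k).
have sum_w k : \sum_s w (beta k) s <= D %/ b + Q * Q.
  rewrite big_split /= sum1_card card_prod card_ord leq_add2r.
  have kG : (beta k).1 < G /\ (beta k).2 < G.
    have /andP[h1 _] := @shift_origin_ge b.+2 (tau k) (I k) isT (ltn_ord _).
    have /andP[h2 _] := @shift_origin_ge b.+2 (tau k) (J k) isT (ltn_ord _).
    have [g1 g2] := cG k.
    split; [apply: leq_ltn_trans g1|apply: leq_ltn_trans g2];
      [apply: leq_trans h1 _|apply: leq_trans h2 _]; exact: leq_div.
  have h := sum_max_cell_le (H (Ordinal kG.1, Ordinal kG.2)).
  rewrite leq_divRL // big_distrl /=.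
  by apply: leq_trans h; apply: leq_sum => t _; rewrite leq_trunc_div.
have colP k : col k < D %/ b + Q * Q.
  by apply: leq_trans (sum_w k); apply: sum_index_lt.
exists (fun k => (tau k, Ordinal (colP k))) => k k' /eqP kk' [tt' cc' [n1 n1' n2 n2']].
have /andP[ti tj] := tauP k; have /andP[ti' tj'] := tauP k'.
(* Neither block is removed by the common shift, and close points have equal or adjacent blocks in
   each coordinate, so both lie in the same box. *)
have bb' : beta k = beta k'.
  rewrite /beta tt'; congr pair; apply: shift_origin_near;
    rewrite -1?tt' // ?near_divn // ?tt' //.
have := cc'; rewrite /col bb' => /sum_index_inj [||ss' rr'] //.
  by rewrite -bb'.
have [s1 s2] : (c k).1 %% Q = (c k').1 %% Q /\ (c k).2 %% Q = (c k').2 %% Q.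
  by case: ss'.
have cell : c k = c k'.
  rewrite [LHS]surjective_pairing [RHS]surjective_pairing.
  by congr pair; apply: near_modn s1 || apply: near_modn s2.
apply: kk'; apply: (cell_rank_inj cell).
(* The colour determines the quotient of the rank, and the shift its remainder, because
   [kept_shifts] has no repetition. *)
rewrite (divn_eq (cell_rank c k) b) (divn_eq (cell_rank c k') b) rr'; congr (_ + _).
have -> : cell_rank c k %% b = index (tau k) (kept_shifts b.+2 (I k) (J k)).
  rewrite index_uniq ?enum_uniq //.
  by apply: leq_trans (size_kept_shifts _ _ _); rewrite ltn_pmod.
have -> : cell_rank c k' %% b = index (tau k') (kept_shifts b.+2 (I k') (J k')).
  rewrite index_uniq ?enum_uniq //.
  by apply: leq_trans (size_kept_shifts _ _ _); rewrite ltn_pmod.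
by rewrite tt' /I /J cell.
Qed.

(** * From proper colourings to training sequences *)

Local Open Scope classical_set_scope.
Local Open Scope ring_scope.

(** Each user sends the standard basis vector of its colour. By the triangle inequality, users
    sharing an RRH are at distance less than [r + r], hence have different colours and orthogonal
    vectors. *)
Lemma min_training_length_le (R : realType) (K N : nat) (r : R)
    (u : 'I_K -> R * R) (b : 'I_N -> R * R) (C : finType) (f : 'I_K -> C) :
  (forall k k', k != k' -> `|u k - u k'| < r + r -> f k != f k') ->
  (min_training_length r u b <= #|C|)%N.
Proof.
move=> proper; rewrite /min_training_length; case: ex_minnP => m _; apply.
apply/asboolP; exists (fun k => delta_mx 0 (enum_rank (f k))); split => [k|i k k'].
  apply/negP => /eqP/matrixP/(_ 0 (enum_rank (f k))); rewrite !mxE !eqxx => /eqP.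
  by rewrite oner_eq0.
rewrite !inE /served => ki k'i kk'.
have /negbTE ff' : f k != f k'.
  apply: proper kk' _; rewrite -(subrKA (b i)); apply: le_lt_trans (ler_normD _ _) _.
  by rewrite ltrD // -normrN opprB.
rewrite dotmxE mxE big1// => j _; rewrite !mxE !eqxx /=.
have [->|_] := eqVneq j (enum_rank (f k)); last by rewrite mul0r.
by rewrite (inj_eq enum_rank_inj) ff' /= conjC0 mulr0.
Qed.

(** * Counting points in cells *)

Lemma sum_subset_exp (R : comPzRingType) (n : nat) (A : {set 'I_n}) (y : R) :
  \sum_(J : {set 'I_n} | J \subset A) y ^+ #|J| = (1 + y) ^+ #|A|.
Proof.
(* Expanding this product over subsets gives the sum; its factors outside [A] equal 1. *)
transitivity (\prod_(i < n) (y * (i \in A)%:R + 1)); last first.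
  rewrite (bigID (mem A)) /= [X in _ * X]big1 => [|i /negbTE ->]; last first.
    by rewrite mulr0 add0r.
  rewrite mulr1 -prodr_const; apply: eq_bigr => i ->; by rewrite mulr1 addrC.
rewrite bigA_distr /= big_mkcond; apply: eq_bigr => J _.
rewrite -big_mkcond /= big_split /= prodr_const.
case: ifPn => [/fintype.subsetP JA|].
  by rewrite big1 ?mulr1 // => i /JA ->.
by case/fintype.subsetPn => i iJ iA; rewrite (bigD1 i) //= (negbTE iA) mul0r mulr0.
Qed.

(* Markov's inequality for (1 + y) ^ (number of E k that occur), which expands
   as the sum over J of y ^ #|J| times the indicator of the events in J. *)
Lemma chernoff_count d (T : measurableType d) (R : realType)
    (P : probability T R) (n m : nat) (E : 'I_n -> set T) (p y : R) :
  0 <= y -> (forall k, measurable (E k)) ->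
  (forall J : {set 'I_n}, P (\bigcap_(k in [set` J]) E k) <= (p ^+ #|J|)%:E)%E ->
  measurable [set w | (m <= #|[set k | w \in E k]%SET|)%N] /\
  (P [set w | (m <= #|[set k | w \in E k]%SET|)%N] <=
    ((1 + y * p) ^+ n / (1 + y) ^+ m)%:E)%E.
Proof.
move=> y0 mE PE.
pose EJ (J : {set 'I_n}) := \bigcap_(k in [set` J]) E k.
have mEJ J : measurable (EJ J).
  by apply: fin_bigcap_measurable => // k _.
set C := [set w | _].
have mC : measurable C.
  have -> : C = \bigcup_(J in [set J : {set 'I_n} | (m <= #|J|)%N]) EJ J.
    apply/seteqP; split=> w /=.
      by move=> mw; exists [set k | w \in E k]%SET => //= k /=; rewrite inE => /set_mem.
    move=> [J /= mJ wJ]; apply: (leq_trans mJ); apply/subset_leq_card/fintype.subsetP => k kJ.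
    by rewrite inE; apply/mem_set/wJ.
  by apply: fin_bigcup_measurable.
split=> //.
have y1 : 0 < (1 + y) ^+ m by rewrite exprn_gt0 // ltr_pwDl.
rewrite EFinM lee_pdivlMr //.
have -> : (P C * ((1 + y) ^+ m)%:E = \int[P]_w ((1 + y) ^+ m * \1_C w)%:E)%E.
  under eq_integral do rewrite EFinM.
  rewrite ge0_integralZl ?integral_indic ?setIT //; [by rewrite muleC| |].
  - by apply/measurable_EFinP; exact: measurable_indic.
  - by rewrite lee_fin ltW.
apply: (@le_trans _ _ (\int[P]_w (\sum_(J : {set 'I_n}) (y ^+ #|J| * \1_(EJ J) w)%:E))%E).
  apply: ge0_le_integral => //.
  - by move=> w _; rewrite lee_fin mulr_ge0 // ltW.
  - apply/measurable_EFinP/measurable_funM => //; exact: measurable_indic.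
  - apply: emeasurable_sum => J; apply/measurable_EFinP/measurable_funM => //.
  move=> w _; rewrite sumEFin lee_fin.
  have -> : \sum_(J : {set 'I_n}) y ^+ #|J| * \1_(EJ J) w =
     (1 + y) ^+ #|[set k | w \in E k]%SET|.
    rewrite -sum_subset_exp [RHS]big_mkcond /=; apply: eq_bigr => J _.
    rewrite indicE; case: ifPn => [/fintype.subsetP JE|/negP JE].
      rewrite mem_set ?mulr1 // => k /= /JE; by rewrite inE => /set_mem.
    rewrite memNset ?mulr0 // => wJ; apply: JE; apply/fintype.subsetP => k kJ.
    by rewrite inE; apply/mem_set/wJ.
  rewrite indicE; case: (boolP (w \in C)) => [/set_mem /= mw|_]; last first.
    by rewrite mulr0 exprn_ge0 // addr_ge0.
  by rewrite mulr1 ler_weXn2l // lerDl.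
rewrite ge0_integral_sum //; first last.
- by move=> J w _; rewrite lee_fin mulr_ge0 // exprn_ge0.
- by move=> J; apply/measurable_EFinP/measurable_funM => //; exact: measurable_indic.
apply: (@le_trans _ _ (\sum_(J : {set 'I_n}) ((y * p) ^+ #|J|)%:E)%E).
  apply: lee_sum => J _; under eq_integral do rewrite EFinM.
  rewrite ge0_integralZl ?integral_indic ?setIT //; first last.
  - by rewrite lee_fin exprn_ge0.
  - by apply/measurable_EFinP; exact: measurable_indic.
  by rewrite exprMn EFinM lee_pmul // ?lee_fin ?exprn_ge0 // PE.
rewrite sumEFin lee_fin.
have := @sum_subset_exp R n [set: 'I_n]%SET (y * p).
rewrite cardsT card_ord => <-.
by rewrite [leRHS](eq_bigl xpredT) // => J; rewrite finset.subsetT.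
Qed.

(** * Grid squares in the plane *)

Definition grid_cell (R : realType) (eta : R) (z : R * R) : nat * nat :=
  (Num.truncn (z.1 / eta), Num.truncn (z.2 / eta)).

Definition grid_square (R : realType) (eta : R) (ij : nat * nat) : set (R * R) :=
  `[ij.1%:R * eta, ij.1.+1%:R * eta[ `*` `[ij.2%:R * eta, ij.2.+1%:R * eta[.

(** Half-open squares match rounding down. The coordinates must be nonnegative because [Num.truncn]
    sends every negative number to 0. *)
Lemma grid_squareP (R : realType) (eta : R) (ij : nat * nat) (z : R * R) :
  0 < eta -> 0 <= z.1 -> 0 <= z.2 ->
  grid_square eta ij z <-> grid_cell eta z = ij.
Proof.
move=> e0 z1 z2; rewrite /grid_square /grid_cell /=.
have P (i : nat) (t : R) : 0 <= t ->
    (i%:R * eta <= t < i.+1%:R * eta) = (Num.truncn (t / eta) == i).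
  by move=> t0; rewrite truncn_eq ?divr_ge0 // ?(ltW e0) // ler_pdivlMr // ltr_pdivrMr.
rewrite /= !in_itv /= !P //; split=> [[/eqP -> /eqP ->]|]; first by case: ij.
by case: ij => i j [-> ->]; rewrite !eqxx.
Qed.

Lemma measurable_grid_square (R : realType) (eta : R) (ij : nat * nat) :
  measurable (grid_square eta ij).
Proof. by apply: measurableX; exact: measurable_itv. Qed.

Lemma grid_square_measure (R : realType) (eta : R) (ij : nat * nat) : 0 < eta ->
  (lebesgue_measure \x lebesgue_measure)%E (grid_square eta ij) = (eta ^+ 2)%:E.
Proof.
move=> e0; rewrite product_measure1E; [|exact: measurable_itv|exact: measurable_itv].
have L (i : nat) : lebesgue_measure (`[i%:R * eta, i.+1%:R * eta[ : set R) = eta%:E.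
  rewrite lebesgue_measure_itv /= lte_fin ltr_pM2r // ltr_nat ltnSn.
  by rewrite -EFinB -mulrBl -natrB // subSnn mul1r.
by rewrite expr2 EFinM; congr (_ * _)%E; exact: L.
Qed.

(** Rounding down costs up to one extra cell, whence [Q.+1] for a distance of [Q] cells. *)
Lemma grid_cell_near (R : realType) (eta : R) (Q : nat) (x y : R) :
  0 < eta -> 0 <= x -> 0 <= y -> `|x - y| < Q%:R * eta ->
  (Num.truncn (x / eta) < Num.truncn (y / eta) + Q.+1)%N.
Proof.
move=> e0 x0 y0 xy; rewrite addnS ltnS.
rewrite -ltnS truncn_lt_nat ?divr_ge0 // ?(ltW e0) // ltr_pdivrMr //.
have h : y < (Num.truncn (y / eta)).+1%:R * eta.
  by rewrite -ltr_pdivrMr // truncnS_gt.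
rewrite -addSn natrD mulrDl -(subrK y x) addrC.
by apply: ltrD => //; apply: le_lt_trans xy; exact: ler_norm.
Qed.

Lemma grid_cell_bound (R : realType) (eta a : R) (x : R) : 0 < eta -> x <= a ->
  (Num.truncn (x / eta) < (Num.truncn (a / eta)).+1)%N.
Proof.
by move=> e0 xa; rewrite ltnS; apply: le_truncn; rewrite ler_pM2r // invr_gt0.
Qed.

(** * Probability of crowded configurations *)

Lemma measure_finType_union_le d (T : measurableType d) (R : realType)
    (P : probability T R) (I : finType) (A : I -> set T) (e : R) :
  (forall i, measurable (A i)) -> (forall i, P (A i) <= e%:E)%E ->
  measurable (\bigcup_i A i) /\ (P (\bigcup_i A i) <= (#|I|%:R * e)%:E)%E.
Proof.
move=> mA Ae.
have -> : \bigcup_i A i = \big[setU/set0]_(i <- enum I) A i.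
  rewrite -bigcup_seq; apply/seteqP; split => w [i _ wi]; exists i => //=.
  by rewrite mem_enum.
rewrite cardE; elim: (enum I) => [|i s [mU IH]].
  by rewrite big_nil measure0 mul0r; split=> //; exact: measurable0.
rewrite big_cons; split; first exact: measurableU.
rewrite /= -natr1 addrC mulrDl mul1r EFinD.
apply: (le_trans (measureU2 _ (mA i) mU)).
exact: leeD (Ae i) IH.
Qed.

Lemma mutually_independent_users d (T : measurableType d) (R : realType)
    (P : probability T R) (n N : nat) (u : 'I_n -> {RV P >-> (R * R)%type})
    (b : 'I_N -> {RV P >-> (R * R)%type}) :
  mutually_independent (nodes u b) -> mutually_independent u.
Proof.
move=> H J A mA.
have := H [set inl k | k in J]%SET (fun j => match j with inl k => A k | inr _ => setT end).
rewrite big_imset /=; last by move=> ? ? _ _ [].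
move=> <-; last by case=> // i; exact: measurableT.
congr (P _); apply/seteqP; split=> w /= h.
  by move=> _ /= /imsetP[k kJ ->]; exact: h.
by move=> k /= kJ; apply: (h (inl k)); apply/imsetP; exists k.
Qed.

Lemma independent_bigcap_le d (T : measurableType d) (R : realType)
    (P : probability T R) (n : nat) (X : 'I_n -> {RV P >-> (R * R)%type})
    (A : set (R * R)) (p : R) (J : {set 'I_n}) :
  mutually_independent X -> measurable A ->
  (forall k, P (X k @^-1` A) <= p%:E)%E ->
  (P (\bigcap_(k in [set` J]) (X k @^-1` A)) <= (p ^+ #|J|)%:E)%E.
Proof.
move=> indep mA pA; rewrite (indep J (fun=> A)) //.
have fP k : P (X k @^-1` A) = (fine (P (X k @^-1` A)))%:E.
  rewrite fineK // fin_num_measure //.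
  by rewrite -[_ @^-1` _]setTI; exact: measurable_funPT.
rewrite (eq_bigr _ (fun k _ => fP k)) prodEFin lee_fin -prodr_const.
apply: ler_prod => k _; rewrite fine_ge0 //=.
by rewrite -lee_fin -fP.
Qed.

Definition box_region (R : realType) (eta : R) (Q B : nat) (beta : nat * nat)
    (g : {ffun 'I_Q * 'I_Q -> 'I_B * 'I_B}) : set (R * R) :=
  \bigcup_s grid_square eta (box_cell beta (g s) s).

(** Union bound over the [Q * Q] cells, each of area [eta ^+ 2] before it is cut by the square. *)
Lemma uniform_box_region_le d (T : measurableType d) (R : realType)
    (P : probability T R) (a eta : R) (X : {RV P >-> (R * R)%type})
    (Q B : nat) (beta : nat * nat) (g : {ffun 'I_Q * 'I_Q -> 'I_B * 'I_B}) :
  0 < a -> 0 < eta -> uniform_on_square a X ->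
  (P (X @^-1` box_region eta beta g) <= ((Q * Q)%:R * (eta / a) ^+ 2)%:E)%E.
Proof.
move=> a0 e0 unif.
have mX (A : set (R * R)) : measurable A -> measurable (X @^-1` A).
  by move=> mA; rewrite -[_ @^-1` _]setTI; exact: measurable_funPT.
have le1 s : (P (X @^-1` grid_square eta (box_cell beta (g s) s)) <= ((eta / a) ^+ 2)%:E)%E.
  have := unif _ (measurable_grid_square eta (box_cell beta (g s) s)).
  rewrite /distribution /pushforward /= => ->.
  rewrite exprMn exprVn mulrC EFinM; apply: lee_pmul => //;
    rewrite ?lee_fin ?invr_ge0 ?exprn_ge0 ?(ltW a0) //.
  rewrite -(grid_square_measure (box_cell beta (g s) s) e0).
  apply: le_measure; rewrite ?inE; [|exact: measurable_grid_square|exact: subIsetl].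
  apply: measurableI; first exact: measurable_grid_square.
  by apply: measurableX; exact: measurable_itv.
have [_] := measure_finType_union_le
  (fun s => mX _ (measurable_grid_square eta (box_cell beta (g s) s))) le1.
by rewrite card_prod card_ord -preimage_bigcup.
Qed.

Lemma measurable_box_region (R : realType) (eta : R) (Q B : nat) (beta : nat * nat)
    (g : {ffun 'I_Q * 'I_Q -> 'I_B * 'I_B}) : measurable (box_region eta beta g).
Proof.
apply: fin_bigcup_measurable => [|s _]; first exact: finite_finset.
exact: measurable_grid_square.
Qed.

(* The event that some point leaves the square or that one of the cell
   configurations of [shifted_coloring] holds more than D points. *)
Definition crowded (T : Type) (R : realType) (n : nat)
    (X : 'I_n -> T -> R * R) (a eta : R) (Q B D : nat) : set T :=
  (\bigcup_k X k @^-1` ~` (`[0, a] `*` `[0, a])) `|`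
  \bigcup_(c : ('I_(Num.truncn (a / eta)).+1 * 'I_(Num.truncn (a / eta)).+1) *
      {ffun 'I_Q * 'I_Q -> 'I_B * 'I_B})
    [set w | (D < #|[set k | w \in X k @^-1`
       box_region eta (c.1.1 : nat, c.1.2 : nat) c.2]%SET|)%N].

(** Leaving the square has probability 0. The rest is a union bound over the box corners and the
    choices of one cell per class, with [chernoff_count] at threshold [D.+1] for each. *)
Lemma crowded_le d (T : measurableType d) (R : realType) (P : probability T R)
    (n : nat) (X : 'I_n -> {RV P >-> (R * R)%type}) (a eta y : R) (Q B D : nat) :
  0 < a -> 0 < eta -> 0 <= y -> (forall k, uniform_on_square a (X k)) ->
  mutually_independent X ->
  measurable (crowded (fun k => X k : T -> R * R) a eta Q B D) /\
  (P (crowded (fun k => X k : T -> R * R) a eta Q B D) <=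
   (((Num.truncn (a / eta)).+1 ^ 2 * (B * B) ^ (Q * Q))%:R *
     ((1 + y * ((Q * Q)%:R * (eta / a) ^+ 2)) ^+ n / (1 + y) ^+ D.+1))%:E)%E.
Proof.
move=> a0 e0 y0 unif indep.
have mX k (A : set (R * R)) : measurable A -> measurable (X k @^-1` A).
  by move=> mA; rewrite -[_ @^-1` _]setTI; exact: measurable_funPT.
rewrite /crowded; set out := \bigcup_k _; set G := (Num.truncn _).+1.
have msq : measurable (`[0, a] `*` `[0, a] : set (R * R)).
  by apply: measurableX; exact: measurable_itv.
have [mout Pout] : measurable out /\ (P out <= 0)%E.
  have [||mo] := @measure_finType_union_le _ _ _ P _
      (fun k => X k @^-1` ~` (`[0, a] `*` `[0, a])) 0.
  - by move=> k; apply: mX; exact: measurableC.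
  - move=> k; have := unif k _ (measurableC msq).
    by rewrite /distribution /pushforward /= => ->; rewrite setICl measure0 mule0.
  by rewrite mulr0.
set ev := fun c : ('I_G * 'I_G) * {ffun 'I_Q * 'I_Q -> 'I_B * 'I_B} => [set w | _].
have ch (c : ('I_G * 'I_G) * {ffun 'I_Q * 'I_Q -> 'I_B * 'I_B}) :
   measurable (ev c) /\
   (P (ev c) <= ((1 + y * ((Q * Q)%:R * (eta / a) ^+ 2)) ^+ n / (1 + y) ^+ D.+1)%:E)%E.
  apply: (@chernoff_count _ _ _ P n D.+1
    (fun k => X k @^-1` box_region eta (c.1.1 : nat, c.1.2 : nat) c.2) _ _ y0) => [k|J].
    by apply: mX; exact: measurable_box_region.
  apply: independent_bigcap_le => //; first exact: measurable_box_region.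
  by move=> k; exact: uniform_box_region_le.
have [mev Pev] := measure_finType_union_le (fun c => (ch c).1) (fun c => (ch c).2).
split; first exact: measurableU.
apply: (le_trans (measureU2 _ mout mev)).
rewrite -[leRHS]add0e; apply: leeD => //; apply: le_trans Pev _.
by rewrite !card_prod card_ffun !card_prod !card_ord mulnn.
Qed.

Lemma not_crowded_coloring (T : Type) (R : realType) (n : nat)
    (X : 'I_n -> T -> R * R) (a eta : R) (Q b D : nat) (w : T) :
  0 < eta -> (0 < b)%N -> ~ crowded X a eta Q.+1 b.+2 D w ->
  exists f : 'I_n -> 'I_b.+2 * 'I_(D %/ b + Q.+1 * Q.+1),
    forall k k', k != k' -> `|X k w - X k' w| < Q%:R * eta -> f k != f k'.
Proof.
move=> e0 b0 /not_orP[nout nev].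
have sq k : (0 <= (X k w).1 <= a) /\ (0 <= (X k w).2 <= a).
  apply: contrapT => h; apply: nout; exists k => //= -[h1 h2]; apply: h.
have x1 k : 0 <= (X k w).1 by case: (sq k) => /andP[].
have x2 k : 0 <= (X k w).2 by case: (sq k) => _ /andP[].
have [||f fP] := @shifted_coloring n Q.+1 b (Num.truncn (a / eta)).+1 D
    (fun k => grid_cell eta (X k w)) isT b0.
- by move=> k; case: (sq k) => /andP[_ h1] /andP[_ h2]; split; exact: grid_cell_bound.
- move=> beta g; rewrite leqNgt; apply/negP => lt; apply: nev; exists (beta, g) => //=.
  apply: (leq_trans lt); apply/subset_leq_card/fintype.subsetP => k; rewrite !inE.
  move=> /existsP[s /eqP e]; exists s => //.
  by apply/grid_squareP.
exists f => k k' kk' near; apply/negP => /eqP ff'; apply: (fP k k' kk' ff').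
have near' : `|X k' w - X k w| < Q%:R * eta by rewrite distrC.
have lt1 (z : R * R) : `|z.1| <= `|z| by rewrite prod_normE le_max lexx.
have lt2 (z : R * R) : `|z.2| <= `|z| by rewrite prod_normE le_max lexx orbT.
split; apply: grid_cell_near => //.
- exact: le_lt_trans (lt1 (_ - _)) near.
- exact: le_lt_trans (lt1 (_ - _)) near'.
- exact: le_lt_trans (lt2 (_ - _)) near.
- exact: le_lt_trans (lt2 (_ - _)) near'.
Qed.

(** * The rate function *)

(** Applying [ln z <= z - 1] at [z = c / x] bounds the increment of [rate_fun] below by
    [(x - c) * ln c]. *)
Lemma rate_fun_lt (R : realType) (c x : R) :
  1 < c -> c < x -> rate_fun c < rate_fun x.
Proof.
move=> c1 cx; rewrite /rate_fun.
have c0 : 0 < c by apply: lt_trans c1.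
have x0 : 0 < x by apply: lt_trans cx.
have lc : 0 < ln c by rewrite ln_gt0.
have : ln (c / x) <= c / x - 1.
  rewrite -[in leLHS](subrKC 1 (c / x)); apply: le_ln1Dx.
  by rewrite ltrBrDl subrr divr_gt0.
rewrite ln_div // -(ler_pM2l x0) !mulrBr mulr1 (mulrC x (c / x)) divfK ?gt_eqF //.
have : 0 < (x - c) * ln c by rewrite mulr_gt0 // subr_gt0.
lra.
Qed.

Lemma rate_invP (R : realType) (y : R) : 0 <= y ->
  1 <= rate_inv y /\ rate_fun (rate_inv y) = y.
Proof.
(* The upper end for the intermediate value theorem: [rate_fun B = 1 + y * B >= y]. *)
move=> y0; pose B := expR (1 + y).
have B1 : 1 <= B by rewrite -expR0 ler_expR addr_ge0.
have yim : y \in (@rate_fun R) @` `[1, +oo[.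
  apply/mem_set.
  have [||c] := @IVT R (@rate_fun R) 1 B y B1.
  - apply: continuous_in_subspaceT => z /set_mem /=; rewrite in_itv /= => /andP[z1 _].
    apply: cvgD; first by apply: cvgB; [exact: cvg_cst|exact: cvg_id].
    apply: cvgM; first exact: cvg_id.
    by apply: continuous_ln; apply: lt_le_trans z1.
  - have -> : rate_fun 1 = 0 :> R by rewrite /rate_fun ln1 mulr0 addr0 subrr.
    have fB : y <= rate_fun B.
      rewrite /rate_fun /B expRK -/B mulrDr mulr1 addrA subrK.
      by rewrite -[leLHS]mul1r; apply: ler_wpDl => //; apply: ler_wpM2r.
    by rewrite ge_min y0 le_max fB orbT.
  rewrite in_itv /= => /andP[c1 _] <-; exists c => //=.
  by rewrite in_itv /= c1.
split; last exact: (pinvK _ yim).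
(* Surjectivity onto the single value [y] is enough to place [pinv] at [y] inside the half-line. *)
have surj : set_surj `[1, +oo[ [set y] (@rate_fun R) by move=> _ ->; apply/set_mem.
have := @surjpinv_image_sub _ _ (fun=> point) _ _ _ surj (rate_inv y).
by rewrite /= in_itv /= andbT; apply; exists y.
Qed.

(** * Passing to the limit *)

(* Positions in the network of K users are those of the first K points of the
   larger network of n users, rescaled by t. *)
Lemma block_length_le (T : Type) (R : realType) (K n N : nat) (leKn : (K <= n)%N)
    (r t a eta : R) (X : 'I_n -> T -> R * R) (w : T)
    (u : 'I_K -> R * R) (b : 'I_N -> R * R) (Q B D : nat) :
  0 < eta -> 0 < t -> (0 < B)%N ->
  (forall k, u k = t *: X (widen_ord leKn k) w) -> r + r <= t * (Q%:R * eta) ->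
  ~ crowded X a eta Q.+1 B.+2 D w ->
  (min_training_length r u b <= B.+2 * (D %/ B + Q.+1 * Q.+1))%N.
Proof.
move=> e0 t0 B0 uX rQ /(not_crowded_coloring e0 B0)[f fP].
have := @min_training_length_le R K N r u b _ (fun k => f (widen_ord leKn k)).
rewrite card_prod !card_ord; apply=> k k' kk' near; apply: fP.
  by apply: contra_neq kk' => /(congr1 val) /= /val_inj.
rewrite -(ltr_pM2l t0); apply: lt_le_trans rQ; apply: le_lt_trans near.
by rewrite !uX -scalerBr normrZ gtr0_norm.
Qed.

(** Borel-Cantelli: the points lying in infinitely many [E m] form a null set. *)
Lemma ae_eventually_notin d (T : measurableType d) (R : realType)
    (P : probability T R) (E : nat -> set T) (C : R) :
  (forall m, measurable (E m)) ->
  (forall m, P (E m) <= (C / m.+2%:R ^+ 2)%:E)%E ->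
  {ae P, forall w, \forall m \near \oo, ~ E m w}.
Proof.
move=> mE PE.
have C0 : 0 <= C.
  have := le_trans (measure_ge0 P (E 0%N)) (PE 0%N).
  by rewrite lee_fin pmulr_lge0 // invr_gt0.
have /(lim_sup_set_cvg0 mE) lim0 : (\sum_(m <oo) P (E m) < +oo)%E.
  apply: (@le_lt_trans _ _ C%:E); last exact: ltry.
  apply: lime_le; first by apply: is_cvg_nneseries => *; exact: measure_ge0.
  apply: nearW => M.
  (* Telescoping comparison, from [1 / (z + 1) ^ 2 <= 1 / z - 1 / (z + 1)]. *)
  have S : \sum_(0 <= m < M) C / m.+2%:R ^+ 2 <= C * (1 - M.+1%:R^-1).
    elim: M => [|M IH]; first by rewrite big_nil invr1 subrr mulr0.
    rewrite big_nat_recr //=; apply: (le_trans (lerD IH (lexx _))).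
    rewrite -mulrDr; apply: ler_wpM2l => //.
    have M1 : (0 : R) < M.+1%:R by rewrite ltr0n.
    have e : M.+2%:R = M.+1%:R + 1 :> R by rewrite -natr1.
    rewrite e; move: (M.+1%:R) M1 => z z0.
    have z1 : 0 < z + 1 by rewrite addr_gt0.
    have -> : (z + 1)^-1 = z^-1 - (z * (z + 1))^-1 by field; rewrite !gt_eqF.
    have : ((z + 1) ^+ 2)^-1 <= (z * (z + 1))^-1.
      by rewrite lef_pV2 ?posrE ?exprn_gt0 ?mulr_gt0 // expr2 ler_pM2r // lerDl.
    lra.
  apply: (@le_trans _ _ (\sum_(0 <= m < M) (C / m.+2%:R ^+ 2)%:E)%E).
    by apply: lee_sum => m _; exact: PE.
  rewrite sumEFin lee_fin; apply: (le_trans S).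
  by rewrite -[leRHS]mulr1 ler_wpM2l // gerBl.
exists (lim_sup_set E); split=> //.
  by apply: bigcap_measurable => // i _; apply: bigcup_measurable.
move=> w /= h i _; apply: contrapT => h'; apply: h; exists i => // m /= im Em.
by apply: h'; exists m.
Qed.

Lemma limn_esup_le_near (R : realType) (u : nat -> R) (l : R) :
  (\forall K \near \oo, u K <= l) -> (limn_esup (fun K => (u K)%:E) <= l%:E)%E.
Proof.
move=> ul; rewrite /limn_esup limf_esupE.
apply: (@le_trans _ _ (ereal_sup ((fun K => (u K)%:E) @` [set K | u K <= l]))).
  by apply: ereal_inf_lbound; exists [set K | u K <= l].
by apply: ge_ereal_sup => _ [K /= uK <-]; rewrite lee_fin.
Qed.

(** Places [K] between consecutive terms of the subsequence used for Borel-Cantelli; [m] is the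
    largest index whose term is at most [K]. *)
Lemma block_index (q M K : nat) : (0 < q)%N -> (M.+1 ^ q <= K)%N ->
  exists m, (M <= m)%N /\ (m.+1 ^ q <= K < m.+2 ^ q)%N.
Proof.
move=> q0 MK.
have ub m : (m.+1 ^ q <= K)%N -> (m <= K)%N.
  move=> mK; apply: leq_trans mK; apply: leq_trans (leqnSn m) _.
  by rewrite -{1}(expn1 m.+1) leq_pexp2l.
case: (ex_maxnP (ex_intro (fun m => (m.+1 ^ q <= K)%N) M MK) ub) => m mK max.
exists m; split; first exact: max.
by rewrite mK ltnNge; apply/negP => /max; rewrite ltnn.
Qed.

(** Here [h] is the cell side relative to the square, so the mean count is bounded by
    [n * Q ^ 2 * h ^ 2 = kappa * l]. Taking [y = x - 1] in Chernoff's bound gives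
    [exp (- kappa * l * rate_fun x)], at most [m.+2 ^ - (q + 2)] by the condition on [q]. The number
    of boxes is of order at most [n = m.+2 ^ q], which leaves a summable inverse square. *)
Lemma crowded_bound (R : realType) (x kappa : R) (q Q B m n : nat) (l h : R) :
  n = (m.+2 ^ q)%N -> l = ln n%:R -> h = Num.sqrt (kappa * l / n%:R) / Q%:R ->
  1 < x -> 0 < kappa -> (0 < q)%N -> (0 < Q)%N ->
  q%:R + 2 <= kappa * rate_fun x * q%:R ->
  ((Num.truncn h^-1).+1 ^ 2 * (B * B) ^ (Q * Q))%:R *
    ((1 + (x - 1) * ((Q * Q)%:R * h ^+ 2)) ^+ n / x ^+ (Num.truncn (x * kappa * l)).+1)
  <= (2 * Q%:R ^+ 2 / (kappa * ln 2) + 2) * ((B * B) ^ (Q * Q))%:R / m.+2%:R ^+ 2.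
Proof.
move=> nD lD hD x1 k0 q0 Q0 qx.
have M2 : 2 <= m.+2%:R :> R by rewrite ler_nat.
have M0 : 0 < m.+2%:R :> R by rewrite ltr0n.
have nE : n%:R = m.+2%:R ^+ q :> R by rewrite nD natrX.
have n1 : 1 <= n%:R :> R by rewrite nE exprn_ege1 // ler1n.
have n0 : 0 < n%:R :> R by apply: lt_le_trans n1.
have lE : l = q%:R * ln m.+2%:R by rewrite lD nE lnXn // mulr_natl.
have ln2 : 0 < ln 2 :> R by rewrite ln_gt0 // ltr1n.
have l2 : ln 2 <= l.
  rewrite lD ler_ln ?posrE // nE; apply: (le_trans M2).
  by rewrite -[leLHS]expr1 ler_weXn2l // ler1n.
have l0 : 0 < l by apply: lt_le_trans l2.
have Qr : 0 < Q%:R :> R by rewrite ltr0n.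
have kl : 0 < kappa * l / n%:R by rewrite divr_gt0 ?mulr_gt0.
have h0 : 0 < h by rewrite hD divr_gt0 ?sqrtr_gt0.
have hE : (Q * Q)%:R * h ^+ 2 = kappa * l / n%:R.
  rewrite hD expr_div_n sqr_sqrtr ?ltW // natrM -expr2 mulrC divfK //.
  by rewrite expf_neq0 // gt_eqF.
(* The square of [h^-1], the number of cells along a side, is of order [n / l]; [ln 2 <= l] turns
   this into a multiple of [n]. *)
have GE : ((Num.truncn h^-1).+1 ^ 2)%:R <= n%:R * (2 * Q%:R ^+ 2 / (kappa * ln 2) + 2).
  have t1 : (Num.truncn h^-1).+1%:R <= h^-1 + 1.
    by rewrite -natr1 lerD2r truncn_le invr_ge0 ltW.
  rewrite natrX; apply: (@le_trans _ _ ((h^-1 + 1) ^+ 2)).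
    by rewrite ler_sqr ?nnegrE // addr_ge0 // invr_ge0 ltW.
  have hV : h^-1 ^+ 2 = Q%:R ^+ 2 * n%:R / (kappa * l).
    have : h ^+ 2 = kappa * l / n%:R / Q%:R ^+ 2.
      by rewrite -hE natrM -expr2 mulrAC mulfV ?mul1r // expf_neq0 // gt_eqF.
    by rewrite exprVn => ->; field; rewrite !gt_eqF.
  have -> : (h^-1 + 1) ^+ 2 = 2 * h^-1 ^+ 2 + 2 - (h^-1 - 1) ^+ 2 by ring.
  apply: (@le_trans _ _ (2 * h^-1 ^+ 2 + 2)); first by rewrite gerBl sqr_ge0.
  rewrite mulrDr lerD //; last by rewrite ler_peMl.
  rewrite hV; have -> : n%:R * (2 * Q%:R ^+ 2 / (kappa * ln 2)) =
     2 * (Q%:R ^+ 2 * n%:R / (kappa * ln 2)) by field; rewrite !gt_eqF.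
  apply: ler_wpM2l => //; apply: ler_wpM2l; first by rewrite mulr_ge0 ?exprn_ge0 ?ltW.
  by rewrite lef_pV2 ?posrE ?mulr_gt0 // ler_pM2l.
have x0 : 0 < x by apply: lt_trans x1.
have tail : (1 + (x - 1) * ((Q * Q)%:R * h ^+ 2)) ^+ n /
    x ^+ (Num.truncn (x * kappa * l)).+1 <= (m.+2%:R ^+ (q + 2))^-1.
  rewrite hE.
  have up : (1 + (x - 1) * (kappa * l / n%:R)) ^+ n <= expR ((x - 1) * (kappa * l)).
    have -> : (x - 1) * (kappa * l) = (x - 1) * (kappa * l / n%:R) * n%:R.
      by rewrite -mulrA divfK // gt_eqF.
    rewrite expRM_natr; apply: lerXn2r; rewrite ?nnegrE ?expR_ge0 ?expR_ge1Dx //.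
    by rewrite addr_ge0 // mulr_ge0 ?subr_ge0 ?(ltW x1) ?(ltW kl).
  have dn : expR (x * kappa * l * ln x) <= x ^+ (Num.truncn (x * kappa * l)).+1.
    have -> k : x ^+ k = expR (ln x * k%:R) by rewrite expRM_natr lnK.
    rewrite ler_expR mulrC.
    by apply: ler_wpM2l; [rewrite ln_ge0 // ltW|rewrite ltW // truncnS_gt].
  apply: (@le_trans _ _ (expR ((x - 1) * (kappa * l)) / expR (x * kappa * l * ln x))).
    apply: ler_pM => //.
    - by rewrite exprn_ge0 // addr_ge0 // mulr_ge0 ?subr_ge0 ?(ltW x1) ?(ltW kl).
    - by rewrite invr_ge0 exprn_ge0 // ltW.
    - by rewrite lef_pV2 ?posrE ?expR_gt0 ?exprn_gt0.
  rewrite -expRN -expRD -[m.+2%:R]lnK ?posrE // -expRM_natr -expRN ler_expR.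
  have -> : (x - 1) * (kappa * l) - x * kappa * l * ln x =
     - (ln m.+2%:R * (kappa * rate_fun x * q%:R)) by rewrite lE /rate_fun; ring.
  rewrite lerN2 natrD; apply: ler_wpM2l => //.
  by rewrite ln_ge0 // (le_trans _ M2) // ler1n.
rewrite natrM; set G := (_ ^ 2)%:R in GE *; set H := (_ ^ (Q * Q))%:R.
have H0 : 0 <= H by rewrite /H ler0n.
set W := (X in _ <= X * H / _) in GE *.
have -> : W * H / m.+2%:R ^+ 2 = n%:R * W * H * (m.+2%:R ^+ (q + 2))^-1.
  rewrite nE exprD; field; rewrite ?expf_neq0 //= ?gt_eqF //.
apply: ler_pM => //.
- by rewrite mulr_ge0 // /G ler0n.
- rewrite divr_ge0 ?exprn_ge0 //; last exact: ltW.
  by rewrite addr_ge0 // !mulr_ge0 ?subr_ge0 ?exprn_ge0 // ltW.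
- by apply: ler_wpM2r.
Qed.

(** Continuity at 1. Every approximation in [density_ratio_le] loses a factor [g], seven in all, and
    the rounding cost is absorbed by [g - 1]. *)
Lemma slack_exists (R : realType) (c e : R) : 0 < e ->
  exists2 g : R, 1 < g & 4 * g ^+ 7 * c + (g - 1) <= 4 * c + e.
Proof.
move=> e0; pose F (g : R) := 4 * g ^+ 7 * c + (g - 1).
have F1 : F z @[z --> (1 : R)^'+] --> 4 * c.
  have -> : 4 * c = F 1 by rewrite /F expr1n subrr addr0 mulr1.
  apply: cvg_at_right_filter; apply: cvgD.
    apply: cvgM; last exact: cvg_cst.
    by apply: cvgM; [exact: cvg_cst|exact: exprn_continuous].
  by apply: cvgB; [exact: cvg_id|exact: cvg_cst].
have ltF : \forall g \near (1 : R)^'+, F g < 4 * c + e.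
  by apply: (cvgr_lt _ F1); rewrite ltrDl.
have gt1 : \forall g \near (1 : R)^'+, 1 < g by exact: nbhs_right_gt.
have [g [Fg g1]] := @filter_ex _ (nbhs (1 : R)^'+) _ _ (filterI ltF gt1).
by exists g => //; exact: ltW.
Qed.

Lemma near_block_ratio (R : realType) (q : nat) (g : R) : 1 < g ->
  \forall m \near \oo, (m.+2 ^ q)%:R <= g * (m.+1 ^ q)%:R.
Proof.
move=> g1.
have h1 : 1 + harmonic m @[m --> \oo] --> (1 : R).
  by rewrite -[X in _ --> X]addr0; apply: cvgD; [exact: cvg_cst|exact: cvg_harmonic].
have : (1 + harmonic m : R) ^+ q @[m --> \oo] --> (1 : R).
  rewrite -[X in _ --> X](expr1n R q).
  exact: (cvg_comp _ _ h1 (@exprn_continuous R q 1)).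
move=> /cvgr_lt /(_ _ g1); apply: filterS => m /ltW.
have m0 : 0 < m.+1%:R :> R by rewrite ltr0n.
rewrite !natrX -ler_pdivrMr ?exprn_gt0 // => h; apply: le_trans h.
rewrite -expr_div_n lerXn2r ?nnegrE //.
- by rewrite addr_ge0 // harmonic_ge0.
- by rewrite -natr1 mulrDl mulfV ?gt_eqF // mul1r.
Qed.

Lemma near_ln_ge (R : realType) (A : R) : \forall K \near \oo, A <= ln K%:R.
Proof.
near=> K; have AK : expR A <= K%:R by near: K; exact: nbhs_infty_ger.
rewrite -[A]expRK ler_ln ?posrE ?expR_gt0 //.
exact: lt_le_trans (expR_gt0 A) AK.
Unshelve. all: by end_near. Qed.

Lemma nat_gt_exists (R : realType) (A : R) : exists2 k, (0 < k)%N & A <= k%:R.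
Proof. by exists (Num.truncn A).+1 => //; rewrite ltW // truncnS_gt. Qed.

(** The limsup bound up to a fixed error [e], stated as an eventual inequality so that countably
    many values of [e] can be intersected. *)
Lemma density_ratio_le d (T : measurableType d) (R : realType)
    (P : probability T R) (rho e : R) (N : nat -> nat) (r0 r : nat -> R)
    (u : forall K : nat, 'I_K -> {RV P >-> (R * R)%type})
    (b : forall K : nat, 'I_(N K) -> {RV P >-> (R * R)%type}) :
  0 < rho -> 0 < e -> (forall K, 0 < r0 K) -> (forall K, 0 < r K) ->
  (forall K k, uniform_on_square (r0 K) (u K k)) ->
  (forall K, mutually_independent (nodes (u K) (b K))) ->
  nested_users r0 (fun K k => u K k : T -> R * R) ->
  (fun K => user_density K (r0 K) * r K ^+ 2 / ln K%:R) @ \oo --> rho ->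
  {ae P, forall w : T, \forall K \near \oo,
    (min_training_length (r K) (fun k => u K k w) (fun i => b K i w))%:R
      / (user_density K (r0 K) * r K ^+ 2) <= 4 * rate_inv (1 / (4 * rho)) + e}.
Proof.
move=> rho0 e0 r0_gt0 r_gt0 unif indep nested dens.
set c := rate_inv _.
have [c_ge1 fc] : 1 <= c /\ rate_fun c = 1 / (4 * rho).
  by apply: rate_invP; rewrite divr_ge0 // mulr_ge0 // ltW.
(* Strict because [rate_fun 1 = 0]; [rate_fun_lt] then applies at [c]. *)
have c1 : 1 < c.
  rewrite lt_neqAle c_ge1 andbT; apply/eqP => c1; move: fc; rewrite -c1.
  rewrite /rate_fun ln1 mulr0 addr0 subrr => /esym/eqP.
  by rewrite gt_eqF // divr_gt0 // mulr_gt0.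
have [g g1 gc] := @slack_exists R c e e0.
have g0 : 0 < g by apply: lt_trans g1.
have c0 : 0 < c by apply: lt_trans c1.
pose x := g * c.
have cx : c < x by rewrite /x ltr_pMl.
have x1 : 1 < x by apply: lt_trans cx.
have x0 : 0 < x by apply: lt_trans x1.
have fx : 1 < 4 * rho * rate_fun x.
  have := rate_fun_lt c1 cx; rewrite fc ltr_pdivrMr ?mulr_gt0 //.
  by rewrite mulrC.
have g10 : 0 < g - 1 by rewrite subr_gt0.
(* [Q0] makes [((Q0 + 1) / Q0) ^ 2 <= 1 + 3 / Q0 <= g], [B] makes [(B + 2) / B <= g], and [q] gives
   the spare exponent 2 required by [crowded_bound]. *)
have [Q0 Q00 Q0g] := @nat_gt_exists R (3 / (g - 1)).
have [B B0 Bg] := @nat_gt_exists R (2 / (g - 1)).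
have [q q0 qf] := @nat_gt_exists R (2 / (4 * rho * rate_fun x - 1)).
have Q0r : 1 <= Q0%:R :> R by rewrite ler1n.
have Q0r0 : 0 < Q0%:R :> R by rewrite ltr0n.
have Br0 : 0 < B%:R :> R by rewrite ltr0n.
have Qg : (Q0.+1%:R / Q0%:R) ^+ 2 <= g.
  rewrite expr_div_n ler_pdivrMr ?exprn_gt0 // -natr1.
  move: Q0g; rewrite ler_pdivrMr // => h; nra.
have BBg : B.+2%:R <= g * B%:R.
  move: Bg; rewrite ler_pdivrMr // -addn2 natrD; lra.
(* [kappa * ln n] bounds the mean count in [Q0.+1 ^ 2] cells when [Q0] cells span the distance 2r.
   One factor [g] covers the density exceeding [rho], the other the ratio [n / K]. *)
pose kappa := 4 * (Q0.+1%:R / Q0%:R) ^+ 2 * g ^+ 2 * rho.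
have Q1 : 1 <= (Q0.+1%:R / Q0%:R) ^+ 2 :> R.
  by rewrite exprn_ege1 // ler_pdivlMr // mul1r ler_nat.
have kge : 4 * rho <= kappa.
  have : 1 <= (Q0.+1%:R / Q0%:R) ^+ 2 * g ^+ 2.
    by rewrite mulr_ege1 // exprn_ege1 // ltW.
  have -> : kappa = 4 * rho * ((Q0.+1%:R / Q0%:R) ^+ 2 * g ^+ 2) by rewrite /kappa; ring.
  by rewrite ler_pMr // mulr_gt0.
have k0 : 0 < kappa by apply: lt_le_trans kge; rewrite mulr_gt0.
have kle : kappa <= 4 * g ^+ 3 * rho.
  have -> : 4 * g ^+ 3 * rho = 4 * g * g ^+ 2 * rho by ring.
  by rewrite /kappa !ler_pM2r ?exprn_gt0 // ler_pM2l.
have f0 : 0 < rate_fun x.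
  have r4 : 0 < 4 * rho by rewrite mulr_gt0.
  by rewrite -(pmulr_rgt0 _ r4); apply: lt_trans fx.
have qk : q%:R + 2 <= kappa * rate_fun x * q%:R.
  move: qf; rewrite ler_pdivrMr ?subr_gt0 // => h.
  apply: (@le_trans _ _ (4 * rho * rate_fun x * q%:R)); first by lra.
  by apply: ler_wpM2r => //; rewrite ler_pM2r.
pose n m := (m.+2 ^ q)%N.
pose l m : R := ln (n m)%:R.
pose h m : R := Num.sqrt (kappa * l m / (n m)%:R) / Q0.+1%:R.
pose eta m := h m * r0 (n m).
pose D m := Num.truncn (x * kappa * l m).
have n0 m : 0 < (n m)%:R :> R by rewrite ltr0n expn_gt0.
have l0 m : 0 < l m.
  by rewrite ln_gt0 // ltr1n /n -(exp1n q) ltn_exp2r.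
have kl m : 0 < kappa * l m / (n m)%:R by rewrite divr_gt0 // mulr_gt0.
have h0 m : 0 < h m by rewrite divr_gt0 ?sqrtr_gt0.
have eta0 m : 0 < eta m by rewrite mulr_gt0.
pose E m := crowded (fun k => u (n m) k : T -> R * R) (r0 (n m)) (eta m) Q0.+1 B.+2 (D m).
have y0 : 0 <= x - 1 by rewrite subr_ge0 ltW.
have EP m := crowded_le Q0.+1 B.+2 (D m) (r0_gt0 (n m)) (eta0 m) y0 (unif (n m))
  (mutually_independent_users (indep (n m))).
have := @ae_eventually_notin _ _ _ P E
  ((2 * Q0.+1%:R ^+ 2 / (kappa * ln 2) + 2) * ((B.+2 * B.+2) ^ (Q0.+1 * Q0.+1))%:R)
  (fun m => (EP m).1).
have PE m : (P (E m) <= ((2 * Q0.+1%:R ^+ 2 / (kappa * ln 2) + 2) *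
    ((B.+2 * B.+2) ^ (Q0.+1 * Q0.+1))%:R / m.+2%:R ^+ 2)%:E)%E.
  apply: le_trans (EP m).2 _; rewrite lee_fin (subrKC 1 x).
  have -> : r0 (n m) / eta m = (h m)^-1.
    by rewrite /eta invfM mulrCA mulfV ?mulr1 // gt_eqF.
  have -> : eta m / r0 (n m) = h m by rewrite /eta mulfK // gt_eqF.
  exact: (@crowded_bound R x kappa q Q0.+1 B.+2 m (n m) (l m) (h m)).
move=> /(_ PE); apply: filterS => w [M1 _ M1P].
have [M2 _ M2P] := @near_block_ratio R q g g1.
(* [c2] is the total rounding cost of the colouring, independent of [K]. *)
pose M := maxn M1 M2; pose c2 : R := (B.+2 * (Q0.+1 * Q0.+1))%:R.
have dens_lt : \forall K \near \oo, user_density K (r0 K) * r K ^+ 2 / ln K%:R < g * rho.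
  by apply: (cvgr_lt _ dens); rewrite ltr_pMl.
have dens_gt : \forall K \near \oo, rho / g < user_density K (r0 K) * r K ^+ 2 / ln K%:R.
  by apply: (cvgr_gt _ dens); rewrite ltr_pdivrMr // ltr_pMr.
near=> K.
have KM : (M.+1 ^ q <= K)%N by near: K; exact: nbhs_infty_ge.
have [m [Mm /andP[mK Kn]]] := block_index q0 KM.
have m1 : (M1 <= m)%N by apply: leq_trans Mm; exact: leq_maxl.
have m2 : (M2 <= m)%N by apply: leq_trans Mm; exact: leq_maxr.
have nE : ~ E m w by exact: M1P.
have K0 : 0 < K%:R :> R by rewrite ltr0n; apply: leq_trans mK; rewrite expn_gt0.
have nK : (n m)%:R <= g * K%:R.
  by apply: le_trans (M2P m m2) _; rewrite ler_pM2l // ler_nat.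
have L1 : 1 <= ln K%:R :> R by near: K; exact: near_ln_ge.
(* This yields [ln (g * K) <= g * ln K], and the next bound yields
   [c2 <= (g - 1) * (rho / g) * ln K]. *)
have lg : ln g / (g - 1) <= ln K%:R by near: K; exact: near_ln_ge.
have cL : c2 * g / (rho * (g - 1)) <= ln K%:R by near: K; exact: near_ln_ge.
have dK_lt : user_density K (r0 K) * r K ^+ 2 / ln K%:R < g * rho by near: K.
have dK_gt : rho / g < user_density K (r0 K) * r K ^+ 2 / ln K%:R by near: K.
set L := ln K%:R in L1 lg cL dK_lt dK_gt.
set dK := user_density K (r0 K) * r K ^+ 2 in dK_lt dK_gt *.
have L0 : 0 < L by apply: lt_le_trans L1.
rewrite ltr_pdivrMr // in dK_lt; rewrite ltr_pdivlMr // in dK_gt.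
have Ll : L <= l m by rewrite ler_ln ?posrE // ler_nat ltnW.
have lL : l m <= g * L.
  apply: (@le_trans _ _ (ln (g * K%:R))).
    by rewrite ler_ln ?posrE // mulr_gt0.
  rewrite lnM ?posrE // -/L; move: lg; rewrite ler_pdivrMr //; lra.
have dK0 : 0 < dK by apply: le_lt_trans dK_gt; rewrite mulr_ge0 ?divr_ge0 ?ltW.
pose t := r0 K / r0 (n m).
have t0 : 0 < t by rewrite divr_gt0.
have uX k : u K k w = t *: u (n m) (widen_ord (ltnW Kn) k) w.
  have := nested K (n m) k (widen_ord (ltnW Kn) k) w erefl.
  move=> /(congr1 (fun z => r0 K *: z)); rewrite !scalerA mulfV ?gt_eqF //.
  by rewrite scale1r.
(* After squaring and cancelling the side length, this is [4 * dK / K <= 4 * g ^ 2 * rho * l m / n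
   m], from [dK < g * rho * L], [n m <= g * K] and [L <= l m]. *)
have cover : r K + r K <= t * (Q0%:R * eta m).
  have -> : t * (Q0%:R * eta m) = r0 K * (Q0%:R * h m).
    by rewrite /t /eta; field; rewrite gt_eqF.
  have -> : r K + r K = 2 * r K by ring.
  rewrite -(@ler_pXn2r _ 2) // ?nnegrE.
  2: by rewrite mulr_ge0 // ltW.
  2: by rewrite !mulr_ge0 // ltW.
  have -> : (r0 K * (Q0%:R * h m)) ^+ 2 = r0 K ^+ 2 * (4 * g ^+ 2 * rho * l m / (n m)%:R).
    have hh : h m ^+ 2 = kappa * l m / (n m)%:R / Q0.+1%:R ^+ 2.
      by rewrite expr_div_n sqr_sqrtr // ltW.
    transitivity (r0 K ^+ 2 * (Q0%:R ^+ 2 * h m ^+ 2)); first by ring.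
    rewrite hh /kappa; field.
    by rewrite !gt_eqF // ltr0n.
  have -> : (2 * r K) ^+ 2 = r0 K ^+ 2 * (4 * dK / K%:R).
    by rewrite /dK /user_density; field; rewrite !gt_eqF.
  rewrite ler_pM2l ?exprn_gt0 // ler_pdivrMr //.
  rewrite mulrAC ler_pdivlMr //.
  have s1 : 4 * dK * (n m)%:R <= 4 * (g * rho * L) * (g * K%:R).
    apply: ler_pM => //; first by rewrite mulr_ge0 // ltW.
    by rewrite ler_pM2l // ltW.
  apply: (le_trans s1).
  have -> : 4 * (g * rho * L) * (g * K%:R) = 4 * g ^+ 2 * rho * K%:R * L by ring.
  have -> : 4 * g ^+ 2 * rho * l m * K%:R = 4 * g ^+ 2 * rho * K%:R * l m by ring.
  by rewrite ler_pM2l // !mulr_gt0 // exprn_gt0.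
have len := block_length_le (fun i => b K i w) (eta0 m) t0 B0 uX cover nE.
rewrite ler_pdivrMr //.
apply: (@le_trans _ _ ((B.+2 * (D m %/ B + Q0.+1 * Q0.+1))%:R)); first by rewrite ler_nat.
have Dle : (B.+2 * (D m %/ B))%:R <= g * (x * kappa * l m).
  rewrite natrM; apply: (@le_trans _ _ (g * B%:R * (D m %/ B)%:R)).
    by apply: ler_wpM2r.
  rewrite -mulrA ler_pM2l // -natrM; apply: (@le_trans _ _ (D m)%:R).
    by rewrite ler_nat mulnC leq_trunc_div.
  by rewrite truncn_le !mulr_ge0 // ltW.
rewrite mulnDr natrD -/c2.
(* One [g] comes from the [B.+2] shifts against [B], three from [kappa], one from [l m <= g * L]. *)
have D2 : g * (x * kappa * l m) <= 4 * g ^+ 5 * rho * x * L.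
  apply: (@le_trans _ _ (g * (x * (4 * g ^+ 3 * rho) * (g * L)))).
    rewrite ler_pM2l //; apply: ler_pM => //; last by rewrite ler_pM2l.
      by rewrite mulr_ge0 // ltW.
    exact: ltW.
  by rewrite le_eqVlt; apply/orP; left; apply/eqP; ring.
have c2L : c2 <= (g - 1) * (rho / g * L).
  move: cL; rewrite ler_pdivrMr ?mulr_gt0 // -ler_pdivlMr // => cL.
  by apply: (le_trans cL); rewrite le_eqVlt; apply/orP; left; apply/eqP; field; rewrite gt_eqF.
(* The last two factors [g] come from [x = g * c] and from the lower bound [rho / g * L] on [dK]. *)
apply: (@le_trans _ _ ((4 * g ^+ 7 * c + (g - 1)) * (rho / g * L))); last first.
  apply: ler_pM => //; last exact: ltW.
  - by rewrite ltW // addr_gt0 // !mulr_gt0 // exprn_gt0.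
  - by rewrite ltW // mulr_gt0 // divr_gt0.
rewrite mulrDl; apply: lerD => //; apply: (le_trans Dle); apply: (le_trans D2).
by rewrite le_eqVlt; apply/orP; left; apply/eqP; rewrite /x; field; rewrite gt_eqF.
Unshelve. all: by end_near. Qed.

Theorem theorem2 (R : realType) (d : measure_display) (T : measurableType d)
    (P : probability T R) (rho : R) (N : nat -> nat) (r0 r : nat -> R)
    (u : forall K : nat, 'I_K -> {RV P >-> (R * R)%type})
    (b : forall K : nat, 'I_(N K) -> {RV P >-> (R * R)%type})
    (rho_gt0 : 0 < rho)
    (r0_gt0 : forall K, 0 < r0 K)
    (r_gt0 : forall K, 0 < r K)
    (users_uniform : forall K k, uniform_on_square (r0 K) (u K k))
    (rrhs_uniform : forall K i, uniform_on_square (r0 K) (b K i))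
    (locations_independent :
       forall K, mutually_independent (nodes (u K) (b K)))
    (users_nested : nested_users r0 (fun K k => u K k : T -> R * R))
    (density_regime :
       (fun K => user_density K (r0 K) * r K ^+ 2 / ln K%:R) @ \oo --> rho) :
  {ae P, forall w : T,
    (limn_esup (fun K =>
       ((min_training_length (r K) (fun k => u K k w) (fun i => b K i w))%:R
          / (user_density K (r0 K) * r K ^+ 2))%:E)
     <= (4 * rate_inv (1 / (4 * rho)))%:E)%E}.
Proof.
set c := rate_inv _.
have e_ge0 (j : nat) : 0 < j.+1%:R^-1 :> R by rewrite invr_gt0 ltr0n.
(* The errors [1 / (j + 1)] give countably many almost sure events, so one null set serves all of
   them. *)
have := ae_foralln (fun j => density_ratio_le rho_gt0 (e_ge0 j) r0_gt0 r_gt0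
  users_uniform locations_independent users_nested density_regime).
apply: filterS => w limw; apply/lee_addgt0Pr => e e0.
have [j _ ej] := nat_gt_exists e^-1.
have je : j.+1%:R^-1 <= e.
  rewrite -[leRHS]invrK lef_pV2 ?posrE ?invr_gt0 ?ltr0n //.
  by apply: le_trans ej _; rewrite ler_nat.
apply: (le_trans (limn_esup_le_near (limw j))).
by rewrite -EFinD lee_fin lerD2l.
Qed.
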